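(* Let $X$ and $Y$ be Banach spaces (over the same field, $\mathbb{R}$ or $\mathbb{C}$) and let $T,S:X\to Y$ be bounded linear operators. Suppose that $S$ is an isomorphism over its image, and let $S^{-1}:S(X)\to X$ denote its inverse. Suppose also that $S(X)$ is complemented in $Y$, and let $p:Y\to Y$ be a continuous linear projection onto $S(X)$. Then $$S^{-1}\left(S(X)\cap \operatorname*{arg\,max}_{\|y\|\leq 1} \left\|\left(T\circ S^{-1}\circ p\right)(y)\right\|\right)\subseteq \operatorname*{arg\,max}_{\|S(x)\|\leq 1}\|T(x)\|.$$ If, in addition, $\|p\|=1$, then $$\operatorname*{arg\,max}_{\|S(x)\|\leq 1}\|T(x)\|= S^{-1}\left(S(X)\cap \operatorname*{arg\,max}_{\|y\|\leq 1} \left\|\left(T\circ S^{-1}\circ p\right)(y)\right\|\right).$$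
   Context: $S$ is an isomorphism over its image if $S:X\to S(X)$ is a bijection with continuous inverse $S^{-1}:S(X)\to X$. A continuous linear projection onto $S(X)$ is a continuous linear map $p:Y\to Y$ with $p\circ p=p$ and $p(Y)=S(X)$. The subspace $S(X)$ is complemented in $Y$ if such a $p$ exists. $\operatorname*{arg\,max}_{\|S(x)\|\leq 1}\|T(x)\|$ is the (possibly empty) set of all $x_0\in X$ with $\|S(x_0)\|\leq 1$ such that $\|T(x_0)\|\geq \|T(x)\|$ for all $x\in X$ with $\|S(x)\|\leq 1$. Likewise, $\operatorname*{arg\,max}_{\|y\|\leq 1}\|(T\circ S^{-1}\circ p)(y)\|$ is the set of all $y_0\in Y$ with $\|y_0\|\le 1$ at which $y\mapsto \|(T\circ S^{-1}\circ p)(y)\|$ attains its maximum over $\{y\in Y:\|y\|\leq 1\}$. *)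

(* Defs.v *)
From HB Require Import structures.
From mathcomp Require Import all_boot all_order all_algebra.
From mathcomp Require Import all_classical all_reals all_analysis.
From mathcomp Require Export complex.

Set Implicit Arguments.
Unset Strict Implicit.
Unset Printing Implicit Defensive.

Import Order.TTheory GRing.Theory Num.Theory.
Import numFieldNormedType.Exports.

Local Open Scope classical_set_scope.
Local Open Scope ring_scope.

Definition real_or_complex (R : realType) (K : numFieldType) : Prop :=
  K = (R : numFieldType) \/ K = (R[i] : numFieldType).

(* Norms take their values in the scalar field K. When K = R[i], [a <= b] means
   that [b - a] is a nonnegative real, so comparing and taking suprema of norms
   is the same as for the corresponding real numbers. *)

Definition bounded_operator (K : numFieldType) (X Y : normedModType K)
    (f : X -> Y) : Prop :=
  exists M : K, forall x, `|f x| <= M * `|x|.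

(* [supremum] defaults to 0 when there is no least upper bound in K, that is,
   for K = R or R[i], when f is unbounded on the unit ball. *)
Definition operator_norm (K : numFieldType) (X Y : normedModType K)
    (f : X -> Y) : K :=
  supremum 0 [set `|f x| | x in [set x | `|x| <= 1]].

(* When S is injective this is the inverse of S : X -> S(X) on [range S];
   elsewhere it takes a default value, which plays no role since it is only
   applied to elements of [range S]. *)
Definition image_inverse (K : numFieldType) (X Y : normedModType K)
    (S : X -> Y) : Y -> X :=
  pinv setT S.

Definition isomorphism_over_image (K : numFieldType) (X Y : normedModType K)
    (S : X -> Y) : Prop :=
  set_bij setT (range S) S /\ {within range S, continuous (image_inverse S)}.

Definition continuous_projection_onto (K : numFieldType) (Y : normedModType K)
    (p : {linear Y -> Y}) (V : set Y) : Prop :=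
  [/\ continuous p, p \o p =1 p & range p = V].

Definition argmax (d : Order.disp_t) (U : Type) (T : porderType d)
    (A : set U) (f : U -> T) : set U :=
  [set x0 | A x0 /\ forall x, A x -> (f x <= f x0)%O].

(* Main.v *)
Require Import Defs.
From HB Require Import structures.
From mathcomp Require Import all_boot all_order all_algebra.
From mathcomp Require Import all_classical all_reals all_analysis.
Import Order.TTheory GRing.Theory Num.Theory.
Import numFieldNormedType.Exports.
Local Open Scope classical_set_scope.
Local Open Scope ring_scope.

(** Since [p] fixes [range S] pointwise, [T \o image_inverse S \o p] takes the value [T x] at [S x].
    A maximiser [S x] over the unit ball of [Y] therefore beats every [S z] in that ball, which
    gives the inclusion. Conversely, the composite at any [y] equals [T z], where [S z = p y]; if
    [p] has norm 1, it maps the unit ball into itself, so [z] is admissible and a maximiser of [T]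
    yields one of the composite. *)

Lemma image_inverseK (K : numFieldType) (X Y : normedModType K) (S : X -> Y) :
  isomorphism_over_image S -> cancel S (image_inverse S).
Proof.
by move=> [[_ injS _] _] x; rewrite /image_inverse pinvKV//; exact: in_setT.
Qed.

(* A nonzero [operator_norm] is not the default value of [supremum], hence is a
   genuine least upper bound. *)
Lemma operator_norm_ub (K : numFieldType) (X Y : normedModType K) (f : X -> Y)
    (x : X) :
  operator_norm f != 0 -> `|x| <= 1 -> `|f x| <= operator_norm f.
Proof.
rewrite /operator_norm /supremum; case: ifPn => [_|_]; first by rewrite eqxx.
case: xgetP => [s _ [ub_s _] _ x1|_]; last by rewrite eqxx.
by apply: ub_s; exists x.
Qed.

Lemma projection_id (K : numFieldType) (Y : normedModType K)
    (p : {linear Y -> Y}) (V : set Y) (y : Y) :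
  continuous_projection_onto p V -> V y -> p y = y.
Proof. by move=> [_ pp <-] [z _ <-]; exact: pp. Qed.

Theorem theorem4p1 (R : realType) (K : numFieldType)
    (hK : real_or_complex R K)
    (X Y : completeNormedModType K)
    (T S : {linear X -> Y})
    (hT : bounded_operator T) (hS : bounded_operator S)
    (hSiso : isomorphism_over_image S)
    (p : {linear Y -> Y})
    (hp : continuous_projection_onto p (range S)) :
  image_inverse S @`
      (range S `&`
       argmax [set y : Y | `|y| <= 1]
              (fun y : Y => `|(T \o image_inverse S \o p) y|))
    `<=` argmax [set x : X | `|S x| <= 1] (fun x : X => `|T x|)
  /\
  (operator_norm p = 1 ->
   argmax [set x : X | `|S x| <= 1] (fun x : X => `|T x|)
   = image_inverse S @`
      (range S `&`
       argmax [set y : Y | `|y| <= 1]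
              (fun y : Y => `|(T \o image_inverse S \o p) y|))).
Proof.
have SK := image_inverseK _ _ _ _ hSiso.
have TpS x : (T \o image_inverse S \o p) (S x) = T x.
  by rewrite /= (projection_id _ _ _ _ _ hp) ?SK//; exists x.
have sub : image_inverse S @` (range S `&` argmax [set y : Y | `|y| <= 1]
      (fun y : Y => `|(T \o image_inverse S \o p) y|))
    `<=` argmax [set x : X | `|S x| <= 1] (fun x : X => `|T x|).
  (* Each competitor [z] for [T] is tested through the point [S z] of the unit ball of [Y]. *)
  move=> _ [_ [[x _ <-] [Sx1 maxSx]] <-]; rewrite SK; split=> // z Sz1.
  by rewrite -!TpS; exact: maxSx.
split=> // normp; apply/seteqP; split=> // x [Sx1 maxx].
exists (S x); last exact: SK.
split; first by exists x.
split=> // y y1; rewrite TpS.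
(* A general [y] need not lie in [range S]; its projection does, and the composite sees only
   [p y]. *)
have [z _ Szpy] : range S (p y) by case: hp => _ _ <-; exists y.
rewrite /= -Szpy SK; apply: maxx.
(* [normp] serves twice: 1 is the bound for [p y], and being nonzero it is not the default value of
   [supremum]. *)
by rewrite /= Szpy -normp operator_norm_ub// normp oner_neq0.
Qed.
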